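(* Let $K$ be a field, $A$ a $K$-algebra, $B$ a finite dimensional $K$-algebra with basis $\mathcal{B}=\{b_1,\dots,b_n\}$. Let $\chi\colon A\otimes B\to B\otimes A$ be a $K$-linear map and let $\gamma_i^j\colon A\to A$ ($1\le i,j\le n$) be the $K$-linear maps determined by $\chi(a\otimes b_i)=\sum_{j=1}^n b_j\otimes\gamma_i^j(a)$ for all $a\in A$. Then the following two conditions both hold: (1) $\gamma_i^j(1)=\delta_{ij}1$ for all $i,j$, and (2) $\gamma_i^k(aa')=\sum_j\gamma_j^k(a)\gamma_i^j(a')$ for all $i,k$ and all $a,a'\in A$, if and only if the function $\phi_\chi\colon A\to\operatorname{End}(B\otimes A)_A$ defined by $\phi_\chi(a)(b_k\otimes 1):=\sum_j b_j\otimes\gamma_k^j(a)$ is a morphism of algebras or, equivalently, if and only if the map $\hat\phi_\chi\colon A\to M_n(A)$, that sends $a\in A$ to the matrix of $\phi_\chi(a)$ with respect to the basis $\{b_1\otimes 1,\dots,b_n\otimes 1\}$ of the right $A$-module $B\otimes A$, is a matrix representation.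
   Context: Algebras are associative and unital, algebra morphisms are unital, all maps are $K$-linear, and $\otimes=\otimes_K$. $B\otimes A$ carries its canonical right $A$-module structure (free with basis $b_1\otimes1,\dots,b_n\otimes1$), and $\operatorname{End}(B\otimes A)_A$ is the algebra of right $A$-linear endomorphisms; $\phi_\chi(a)$ is the right $A$-linear map with the given values on the basis. The matrix of a right $A$-linear endomorphism $T$ is $(t_{ij})$ with $T(b_j\otimes1)=\sum_i (b_i\otimes1)t_{ij}$. A matrix representation is a (unital) algebra morphism into $M_n(A)$. *)

(* Defs.v *)
From HB Require Import structures.
From mathcomp Require Import all_boot all_algebra all_field.
From mathcomp Require Import boolp.
From mathcomp.multinomials Require Import freeg.

Set Implicit Arguments.
Unset Strict Implicit.
Unset Printing Implicit Defensive.

Import GRing.Theory.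
Local Open Scope ring_scope.
Local Open Scope quotient_scope.

(* The tensor product of two K-modules: the free module on [U * V], modulo the
   submodule [tensor_rel] generated by the bilinearity relations. *)
Section Tensor.
Variables (K : comNzRingType) (U V : lmodType K).

Notation free := {freeg (U * V)%type / K}.

Inductive tensor_rel : free -> Prop :=
| tensor_rel_linl c u u' v :
    tensor_rel (<< (c *: u + u', v) >> - (c *: << (u, v) >> + << (u', v) >>))
| tensor_rel_linr c u v v' :
    tensor_rel (<< (u, c *: v + v') >> - (c *: << (u, v) >> + << (u, v') >>))
| tensor_rel0 : tensor_rel 0
| tensor_relP c x y : tensor_rel x -> tensor_rel y -> tensor_rel (c *: x + y).

Definition tensor_relb : {pred free} := fun x => `[< tensor_rel x >].

Lemma tensor_relb_zmod : zmod_closed tensor_relb.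
Proof.
split=> [|x y /asboolP x0 /asboolP y0]; apply/asboolP; first exact: tensor_rel0.
by rewrite -scaleN1r addrC; apply: tensor_relP.
Qed.

HB.instance Definition _ := GRing.isZmodClosed.Build free tensor_relb
  tensor_relb_zmod.

Definition tensor : Type :=
  Quotient.quot (GRing.ZmodClosed.clone free tensor_relb _).
HB.instance Definition _ := GRing.Zmodule.on tensor.
HB.instance Definition _ := Quotient.on tensor.

Lemma tensor_relbP (x : free) : reflect (tensor_rel x) (tensor_relb x).
Proof. exact: asboolP. Qed.

Lemma tensor_piP (x y : free) :
  reflect (\pi_tensor x = \pi_tensor y) (tensor_relb (x - y)).
Proof. by rewrite -[tensor_relb _]Quotient.equivE; apply: eqquotP. Qed.

Lemma tensor_piB : {morph \pi_tensor : x y / x - y}.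
Proof. exact: (raddfB (\pi_(Quotient.quot tensor_relb))). Qed.

Lemma tensor_piD : {morph \pi_tensor : x y / x + y}.
Proof. exact: (raddfD (\pi_(Quotient.quot tensor_relb))). Qed.

Definition tensor_scale (c : K) (x : tensor) : tensor :=
  \pi_tensor (c *: repr x).

Lemma tensor_pi_scale c x : \pi_tensor (c *: x) = tensor_scale c (\pi_tensor x).
Proof.
apply/tensor_piP; rewrite -scalerBr -[X in tensor_relb X]addr0.
apply/tensor_relbP/tensor_relP; last exact: tensor_rel0.
by apply/tensor_relbP/tensor_piP; rewrite reprK.
Qed.

Lemma tensor_scaleA a b x :
  tensor_scale a (tensor_scale b x) = tensor_scale (a * b) x.
Proof. by rewrite -[x]reprK -(tensor_pi_scale b) -!tensor_pi_scale scalerA. Qed.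

Lemma tensor_scale1 : left_id 1 tensor_scale.
Proof. by move=> x; rewrite -[x]reprK -tensor_pi_scale scale1r. Qed.

Lemma tensor_scaleDr : right_distributive tensor_scale +%R.
Proof.
move=> c x y; rewrite -[x]reprK -[y]reprK -tensor_piD -!tensor_pi_scale.
by rewrite scalerDr tensor_piD.
Qed.

Lemma tensor_scaleDl x : {morph tensor_scale^~ x : a b / a + b}.
Proof.
by move=> a b /=; rewrite -[x]reprK -!tensor_pi_scale scalerDl tensor_piD.
Qed.

HB.instance Definition _ := GRing.Zmodule_isLmodule.Build K tensor
  tensor_scaleA tensor_scale1 tensor_scaleDr tensor_scaleDl.

Lemma tensor_piZ c : {morph \pi_tensor : x / c *: x}.
Proof. exact: tensor_pi_scale. Qed.

Definition tens (u : U) (v : V) : tensor := \pi_tensor << (u, v) >>.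

Lemma tens_linearl v : linear (tens^~ v).
Proof.
move=> c u u'; rewrite /tens -tensor_piZ -tensor_piD.
by apply/tensor_piP/tensor_relbP/tensor_rel_linl.
Qed.

Lemma tens_linearr u : linear (tens u).
Proof.
move=> c v v'; rewrite /tens -tensor_piZ -tensor_piD.
by apply/tensor_piP/tensor_relbP/tensor_rel_linr.
Qed.

HB.instance Definition _ := bilinear_isBilinear.Build K U V tensor *:%R *:%R
  tens (tens_linearl, tens_linearr).

Section Lift.
Variables (W : lmodType K) (f : {bilinear U -> V -> W}).

Definition free_lift (x : free) : W := fglift (fun uv => f uv.1 uv.2) x.

Fact free_lift_zmod_morphism : zmod_morphism free_lift.
Proof. exact: lift_is_additive. Qed.
HB.instance Definition _ := GRing.isZmodMorphism.Build free W free_lift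
  free_lift_zmod_morphism.

Fact free_liftU c u v : free_lift << c *g (u, v) >> = c *: f u v.
Proof. exact: liftU. Qed.

Fact free_lift_scalable : scalable free_lift.
Proof.
move=> c x; rewrite [c *: x]/(fgscale c x) /fgscale raddf_sum.
rewrite -[in RHS](freeg_sumE x) raddf_sum scaler_sumr; apply: eq_bigr => -[u v] _.
by rewrite /= !free_liftU scalerA.
Qed.
HB.instance Definition _ := GRing.isScalable.Build K free W *:%R free_lift free_lift_scalable.

Fact free_lift_rel x : tensor_rel x -> free_lift x = 0.
Proof.
elim=> [c u u' v|c u v v'||c {}x y _ IHx _ IHy]; rewrite ?raddf0 //.
- by rewrite raddfB raddfD /= free_lift_scalable !free_liftU !scale1r linearPl subrr.
- by rewrite raddfB raddfD /= free_lift_scalable !free_liftU !scale1r linearPr subrr.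
- by rewrite raddfD /= free_lift_scalable IHx IHy scaler0 addr0.
Qed.

Definition tensor_lift (t : tensor) : W := free_lift (repr t).

Fact tensor_lift_pi x : tensor_lift (\pi_tensor x) = free_lift x.
Proof.
apply/eqP; rewrite -subr_eq0 -raddfB; apply/eqP/free_lift_rel/tensor_relbP.
by apply/tensor_piP; rewrite reprK.
Qed.

Fact tensor_lift_linear : linear tensor_lift.
Proof.
move=> c x y; rewrite -[x]reprK -[y]reprK -tensor_piZ -tensor_piD.
by rewrite !tensor_lift_pi linearP.
Qed.
HB.instance Definition _ := GRing.isLinear.Build K tensor W *:%R tensor_lift
  tensor_lift_linear.

Lemma tensor_liftE u v : tensor_lift (tens u v) = f u v.
Proof. by rewrite tensor_lift_pi free_liftU scale1r. Qed.
End Lift.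

Lemma tensor_ext (W : lmodType K) (f g : {linear tensor -> W}) :
  (forall u v, f (tens u v) = g (tens u v)) -> f =1 g.
Proof.
move=> fg t; have [D ->] : exists D, t = \pi_tensor D.
  by exists (repr t); rewrite reprK.
pose h x := f (\pi_tensor x) - g (\pi_tensor x).
have hD : {morph h : x y / x + y}.
  by move=> x y; rewrite /h tensor_piD !raddfD addrACA.
have h0 : h 0 = 0 by apply: (addrI (h 0)); rewrite -hD !addr0.
apply/eqP; rewrite -subr_eq0 -/(h D) -[D]freeg_sumE (big_morph h hD h0).
apply/eqP/big1 => -[u v] _.
have -> : << coeff (u, v) D *g (u, v) >>
        = coeff (u, v) D *: << (u, v) >> :> free.
  by apply/eqP/freeg_eqP => z; rewrite coeffZ !coeffU mul1r.
rewrite /h tensor_piZ [f _]linearZ [g _]linearZ /=.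
by rewrite -/(tens u v) fg subrr.
Qed.
End Tensor.

Notation "U ⊗ V" := (tensor U V) (at level 40, left associativity) : type_scope.
Notation "u ⊗ v" := (tens u v) (at level 40, left associativity) : ring_scope.

(* [rtensor B A] is [B ⊗ A] as a right A-module, [(b ⊗ a) a' = b ⊗ (a a')];
   right A-modules are left modules over the converse ring [A^c]. *)
Section RightModule.
Variables (K : comNzRingType) (B : lmodType K) (A : algType K).

Definition tens_mulr (a' : A) (b : B) (a : A) : B ⊗ A := b ⊗ (a * a').

Fact tens_mulr_bilinear a' :
  bilinear_for (GRing.Scale.Law.clone _ _ *:%R _)
    (GRing.Scale.Law.clone _ _ *:%R _) (tens_mulr a').
Proof.
split=> [a|b] c x y; rewrite /tens_mulr /= ?linearPl //.
by rewrite mulrDl -scalerAl linearPr.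
Qed.
HB.instance Definition _ a' := bilinear_isBilinear.Build K B A (B ⊗ A)%type
  *:%R *:%R (tens_mulr a') (tens_mulr_bilinear a').

Definition rtensor : Type := B ⊗ A.
HB.instance Definition _ := GRing.Zmodule.on rtensor.

Definition rtensor_scale (a : A^c) (t : rtensor) : rtensor :=
  tensor_lift (tens_mulr a) t.

Lemma rtensor_scaleE (a' : A^c) b (a : A) :
  rtensor_scale a' (b ⊗ a) = b ⊗ (a * (a' : A)).
Proof. by rewrite /rtensor_scale tensor_liftE. Qed.

Lemma rtensor_scaleA a a' t :
  rtensor_scale a (rtensor_scale a' t) = rtensor_scale (a * a') t.
Proof.
pose f := tensor_lift (tens_mulr a) \o tensor_lift (tens_mulr a').
apply: (@tensor_ext _ _ _ _ f (tensor_lift (tens_mulr (a * a')))) => b x /=.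
rewrite !tensor_liftE.
exact: (congr1 (tens b) (esym (mulrA x (a' : A) (a : A)))).
Qed.

Lemma rtensor_scale1 : left_id 1 rtensor_scale.
Proof.
apply: (@tensor_ext _ _ _ _ (tensor_lift (tens_mulr 1)) idfun) => b x /=.
rewrite tensor_liftE.
exact: (congr1 (tens b) (mulr1 x)).
Qed.

Lemma rtensor_scaleDr : right_distributive rtensor_scale +%R.
Proof. by move=> a t u; apply: raddfD. Qed.

Lemma rtensor_scaleDl t : {morph rtensor_scale^~ t : a a' / a + a'}.
Proof.
move=> a a'.
pose f := tensor_lift (tens_mulr a) \+ tensor_lift (tens_mulr a').
apply: (@tensor_ext _ _ _ _ (tensor_lift (tens_mulr (a + a'))) f) => b x /=.
rewrite !tensor_liftE /=.
by rewrite /tens_mulr [X in b ⊗ X](mulrDr x (a : A) (a' : A)) linearDr.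
Qed.

HB.instance Definition _ := GRing.Zmodule_isLmodule.Build A^c rtensor
  rtensor_scaleA rtensor_scale1 rtensor_scaleDr rtensor_scaleDl.

(* The K-module structures on [B ⊗ A] and [rtensor B A] agree. *)
Lemma rtensor_scale_alg (c : K) (t : rtensor) :
  (c%:A : A^c) *: t = c *: (t : B ⊗ A).
Proof.
apply: (@tensor_ext _ _ _ _ (tensor_lift (tens_mulr c%:A)) (c \*: idfun)).
move=> b a /=; rewrite tensor_liftE -linearZr_LR.
exact: (congr1 (tens b) (mulr_algr c a)).
Qed.
End RightModule.

Section RightEndomorphisms.
Variables (K : comNzRingType) (A : algType K) (M : lmodType A^c).

Definition rEnd : Type := {linear M -> M}.
HB.instance Definition _ := gen_eqMixin rEnd.
HB.instance Definition _ := gen_choiceMixin rEnd.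

Lemma rEndP (f g : rEnd) : f =1 g -> f = g.
Proof.
case: f g => [f [[fD] [fZ]]] [g [[gD] [gZ]]] /= /funext fg.
by case: _ / fg in gD gZ *; rewrite (Prop_irrelevance gD fD)
  (Prop_irrelevance gZ fZ).
Qed.

Lemma rEndZ (f : rEnd) (a : A^c) (x : M) : f (a *: x) = a *: f x.
Proof. exact: linearZ_LR. Qed.

Definition rend_zero : rEnd := \0 : M -> M.
Definition rend_opp (f : rEnd) : rEnd := \- f.
Definition rend_add (f g : rEnd) : rEnd := f \+ g.
Definition rend_one : rEnd := idfun.
Definition rend_mul (f g : rEnd) : rEnd := f \o g.

Fact rend_addA : associative rend_add.
Proof. by move=> f g h; apply: rEndP => x; apply: addrA. Qed.
Fact rend_addC : commutative rend_add.
Proof. by move=> f g; apply: rEndP => x; apply: addrC. Qed.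
Fact rend_add0 : left_id rend_zero rend_add.
Proof. by move=> f; apply: rEndP => x; apply: add0r. Qed.
Fact rend_addN : left_inverse rend_zero rend_opp rend_add.
Proof. by move=> f; apply: rEndP => x; apply: addNr. Qed.
HB.instance Definition _ := GRing.isZmodule.Build rEnd
  rend_addA rend_addC rend_add0 rend_addN.

Fact rend_mulA : associative rend_mul.
Proof. by move=> f g h; apply: rEndP. Qed.
Fact rend_mul1 : left_id rend_one rend_mul.
Proof. by move=> f; apply: rEndP. Qed.
Fact rend_mulr1 : right_id rend_one rend_mul.
Proof. by move=> f; apply: rEndP. Qed.
Fact rend_mulDl : left_distributive rend_mul +%R.
Proof. by move=> f g h; apply: rEndP. Qed.
Fact rend_mulDr : right_distributive rend_mul +%R.
Proof. by move=> f g h; apply: rEndP => x; apply: raddfD. Qed.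
HB.instance Definition _ := GRing.Zmodule_isPzRing.Build rEnd
  rend_mulA rend_mul1 rend_mulr1 rend_mulDl rend_mulDr.

(* K acts through A: [(c *: f) x = f x (c 1)]. *)
Definition rend_scale_fun (c : K) (f : rEnd) (x : M) : M :=
  (c%:A : A^c) *: f x.

Fact rend_scale_linear c f : linear (rend_scale_fun c f).
Proof.
move=> a x y; rewrite /rend_scale_fun linearP scalerDr !scalerA.
congr (_ *: _ + _).
exact: etrans (mulr_algr c (a : A)) (esym (mulr_algl c (a : A))).
Qed.
HB.instance Definition _ c f := GRing.isLinear.Build A^c M M *:%R
  (rend_scale_fun c f) (rend_scale_linear c f).

Definition rend_scale (c : K) (f : rEnd) : rEnd := rend_scale_fun c f.

Fact rend_scaleA a b f : rend_scale a (rend_scale b f) = rend_scale (a * b) f.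
Proof.
apply: rEndP => x /=; rewrite /rend_scale_fun /= /rend_scale_fun scalerA.
by congr (_ *: _); rewrite [LHS](mulr_algl b) scalerA mulrC.
Qed.
Fact rend_scale1 : left_id 1 rend_scale.
Proof.
by move=> f; apply: rEndP => x; rewrite /= /rend_scale_fun !scale1r.
Qed.
Fact rend_scaleDr : right_distributive rend_scale +%R.
Proof. by move=> c f g; apply: rEndP => x; apply: scalerDr. Qed.
Fact rend_scaleDl f : {morph rend_scale^~ f : a b / a + b}.
Proof.
by move=> a b; apply: rEndP => x; rewrite /= /rend_scale_fun /= scalerDl
  [LHS]scalerDl.
Qed.
HB.instance Definition _ := GRing.Zmodule_isLmodule.Build K rEnd
  rend_scaleA rend_scale1 rend_scaleDr rend_scaleDl.

Lemma rend_scaleAl (c : K) (f g : rEnd) : c *: (f * g) = (c *: f) * g.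
Proof. exact: rEndP. Qed.
Lemma rend_scaleAr (c : K) (f g : rEnd) : c *: (f * g) = f * (c *: g).
Proof. by apply: rEndP => x; apply: esym; apply: rEndZ. Qed.
End RightEndomorphisms.

Definition algebra_morphism_for (K : pzRingType) (A : algType K)
    (C : pzRingType) (s : K -> C -> C) (f : A -> C) : Prop :=
  linear_for s f /\ monoid_morphism f.

Definition rend_algebra_morphism (K : comNzRingType) (A : algType K)
    (M : lmodType A^c) (f : A -> rEnd M) : Prop :=
  algebra_morphism_for (fun (c : K) (T : rEnd M) => c *: T) f.

(* The library's scaling on ['M[A]_n] is by A, not by the base field. *)
Definition mx_scale (K : pzRingType) (A : lmodType K) n (c : K)
  (M : 'M[A]_n) : 'M[A]_n := map_mx ( *:%R c) M.

Definition matrix_representation (K : pzRingType) (A : algType K) n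
  (r : A -> 'M[A]_n) : Prop := algebra_morphism_for (@mx_scale K A n) r.

Section RightBasis.
Variables (K : fieldType) (A : algType K) (B : vectType K).
Variables (n : nat) (b : n.-tuple B).
Implicit Types (t : rtensor B A) (f g : rEnd (rtensor B A)).

Definition rcoord_form (i : 'I_n) (x : B) (a : A) : A := coord b i x *: a.

Fact rcoord_form_bilinear i :
  bilinear_for (GRing.Scale.Law.clone _ _ *:%R _)
    (GRing.Scale.Law.clone _ _ *:%R _) (rcoord_form i).
Proof.
split=> [a|x] c y z; rewrite /rcoord_form /=.
  by rewrite linearP scalerDl scalerA.
by rewrite scalerDr !scalerA mulrC.
Qed.
HB.instance Definition _ i := bilinear_isBilinear.Build K B A A *:%R *:%R
  (rcoord_form i) (rcoord_form_bilinear i).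

(* The coordinates of [t] in the right A-basis [b_1 ⊗ 1, ..., b_n ⊗ 1],
   when [b] is a basis of [B]: see [rtensor_coord]. *)
Definition rcoord (i : 'I_n) t : A := tensor_lift (rcoord_form i) t.

Lemma rcoordE i x (a : A) : rcoord i (x ⊗ a) = coord b i x *: a.
Proof. exact: tensor_liftE. Qed.

Lemma rcoordD i : {morph rcoord i : t u / t + u}.
Proof. exact: raddfD. Qed.

Lemma rcoordZ i (a : A^c) t : rcoord i (a *: t) = rcoord i t * (a : A).
Proof.
pose g := tensor_lift (rcoord_form i) \o tensor_lift (tens_mulr (a : A)).
pose h := (a : A) \o* tensor_lift (rcoord_form i).
apply: (@tensor_ext _ _ _ _ g h) => x y /=.
by rewrite !tensor_liftE /rcoord_form -scalerAl.
Qed.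

Lemma rtensor_coord t : basis_of fullv b ->
  t = \sum_i (rcoord i t : A^c) *: (b`_i ⊗ 1 : rtensor B A).
Proof.
move=> bB; pose h (u : B ⊗ A) := \sum_(i < n) b`_i ⊗ rcoord i u.
have h_lin : linear h.
  move=> c u w; rewrite /h scaler_sumr -big_split; apply: eq_bigr => i _ /=.
  by rewrite /rcoord linearP linearPr.
pose h' : {linear tensor B A -> tensor B A} :=
  HB.pack h (GRing.isLinear.Build K _ _ _ h h_lin).
transitivity (h t); last first.
  apply: eq_bigr => i _; rewrite [RHS]rtensor_scaleE.
  by congr (_ ⊗ _); rewrite mul1r.
apply: (@tensor_ext _ _ _ _ idfun h') => x a /=.
rewrite /h [in LHS](coord_basis bB (memvf x)) linear_sumlz /=.
by apply: eq_bigr => i _; rewrite rcoordE linearZr_LR linearZl_LR.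
Qed.

(* The right A-linear map sending [b_k ⊗ 1] to [v k], see [rextE]. *)
Definition rext_fun (v : 'I_n -> rtensor B A) t : rtensor B A :=
  \sum_i (rcoord i t : A^c) *: v i.

Fact rext_linear v : linear (rext_fun v).
Proof.
move=> a t u; rewrite /rext_fun scaler_sumr -big_split; apply: eq_bigr => i _.
by rewrite rcoordD rcoordZ /= scalerA scalerDl.
Qed.
HB.instance Definition _ v := GRing.isLinear.Build A^c _ _ *:%R
  (rext_fun v) (rext_linear v).

Definition rext (v : 'I_n -> rtensor B A) : rEnd (rtensor B A) := rext_fun v.

Lemma rextE v (k : 'I_n) : basis_of fullv b -> rext v (b`_k ⊗ 1 : rtensor B A) = v k.
Proof.
move=> bB; rewrite /= /rext_fun (bigD1 k) //= big1 => [|i ik].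
  by rewrite rcoordE coord_free ?(basis_free bB) // eqxx !scale1r addr0.
by rewrite rcoordE coord_free ?(basis_free bB) // eq_sym (negPf ik) !scale0r.
Qed.

Lemma rext_unique f g : basis_of fullv b ->
  (forall k : 'I_n, f (b`_k ⊗ 1 : rtensor B A) = g (b`_k ⊗ 1 : rtensor B A)) ->
  f = g.
Proof.
move=> bB fg; apply: rEndP => t; rewrite [t]rtensor_coord // !raddf_sum.
apply: eq_bigr => i _.
by rewrite /= !rEndZ fg.
Qed.

Definition mx_of_rend f : 'M[A]_n :=
  \matrix_(i, j) rcoord i (f (b`_j ⊗ 1 : rtensor B A)).

Lemma mx_of_rendP f (j : 'I_n) : basis_of fullv b ->
  f (b`_j ⊗ 1 : rtensor B A) =
    \sum_i (mx_of_rend f i j : A^c) *: (b`_i ⊗ 1 : rtensor B A).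
Proof.
by move=> bB; rewrite [LHS]rtensor_coord //; apply: eq_bigr => i _; rewrite mxE.
Qed.

(* [gamma i j] is the map written [gamma_i^j] in
   [chi (a ⊗ b_i) = sum_j b_j ⊗ gamma_i^j a]. *)
Variable gamma : 'I_n -> 'I_n -> A -> A.

Definition phi_chi (a : A) : rEnd (rtensor B A) :=
  rext (fun k => \sum_(j < n) b`_j ⊗ gamma k j a).

Lemma phi_chiE a (k : 'I_n) : basis_of fullv b ->
  phi_chi a (b`_k ⊗ 1 : rtensor B A) = \sum_(j < n) b`_j ⊗ gamma k j a.
Proof. exact: rextE. Qed.

Definition phi_hat (a : A) : 'M[A]_n := mx_of_rend (phi_chi a).
End RightBasis.

(* Main.v *)
Require Import Defs.
From HB Require Import structures.
From mathcomp Require Import all_boot all_algebra all_field.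

(** Passing to matrices is an injective map of unital K-algebras from the right
    A-linear endomorphisms of [B ⊗ A] to [n × n] matrices over [A]: a right
    A-linear map is determined by its values on the basis [b_k ⊗ 1]
    ([mx_of_rend_inj]), and composition becomes the product of matrices, in
    the right order because scalars act on the right ([mx_of_rendM]).  Hence
    [phi_chi] is an algebra morphism if and only if [phi_hat] is
    ([phi_chi_morphismP]).

    Now [phi_hat a] is the matrix with entry [gamma_j^i a] in row [i] and
    column [j] ([phi_hatE]), so it depends linearly on [a].  What remains of
    being an algebra morphism is [phi_hat 1 = 1] and
    [phi_hat (a a') = phi_hat a · phi_hat a'], and these are conditions (1) and
    (2) read entry by entry ([phi_hat_representationP]). *)

Set Implicit Arguments.
Unset Strict Implicit.
Unset Printing Implicit Defensive.

Import GRing.Theory.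
Local Open Scope ring_scope.

(** Each algebra law for [f] is an equation in [C], and the injective [h] turns
    it into the corresponding equation for [h \o f], so the two can be
    exchanged. *)
Lemma algebra_morphism_comp_inj (K : pzRingType) (A : algType K)
    (C D : pzRingType) (s : K -> C -> C) (t : K -> D -> D)
    (h : C -> D) (f : A -> C) :
  injective h -> {morph h : x y / x + y} -> monoid_morphism h ->
  (forall c x, h (s c x) = t c (h x)) ->
  algebra_morphism_for s f <-> algebra_morphism_for t (h \o f).
Proof.
move=> h_inj hD [h1 hM] hs; split=> [[f_lin [f1 fM]]|[f_lin [f1 fM]]].
  split; first by move=> c x y /=; rewrite f_lin hD hs.
  by split=> [|x y] /=; rewrite ?f1 ?h1 // fM hM.
split; first by move=> c x y; apply: h_inj; rewrite hD hs -f_lin.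
by split=> [|x y]; apply: h_inj; [rewrite h1 -f1|rewrite hM -fM].
Qed.

Section MatrixOfEndomorphism.
Variables (K : fieldType) (A : algType K) (B : vectType K).
Variables (n : nat) (b : n.-tuple B).
Hypothesis b_basis : basis_of fullv b.
Implicit Types f g : rEnd (rtensor B A).

Lemma rcoord_basis (i k : 'I_n) (a : A) :
  rcoord b i (b`_k ⊗ a) = (i == k)%:R * a.
Proof.
rewrite rcoordE coord_free ?(basis_free b_basis) //.
by rewrite [k == i]eq_sym; case: eqP => _; rewrite ?scale1r ?mul1r ?scale0r ?mul0r.
Qed.

Lemma mx_of_rend_inj : injective (@mx_of_rend K A B n b).
Proof.
move=> f g fg; apply: (rext_unique b_basis) => k.
by rewrite !(mx_of_rendP _ _ b_basis) fg.
Qed.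

Lemma mx_of_rendD : {morph @mx_of_rend K A B n b : f g / f + g}.
Proof. by move=> f g; apply/matrixP => i j; rewrite !mxE [LHS]rcoordD. Qed.

(** The scalar [c] acts on endomorphisms through the central element [c 1] of
    [A], which may be moved from the right of an entry to its left. *)
Lemma mx_of_rendZ (c : K) f : mx_of_rend b (c *: f) = mx_scale c (mx_of_rend b f).
Proof.
apply/matrixP => i j; rewrite !mxE.
exact: etrans (rcoordZ _ _ _ _) (mulr_algr _ _).
Qed.

Lemma mx_of_rend1 : mx_of_rend b (1 : rEnd (rtensor B A)) = 1.
Proof.
apply/matrixP => i j; rewrite !mxE.
exact: etrans (rcoord_basis _ _ _) (mulr1 _).
Qed.

(** Expanding [g (b_j ⊗ 1)] in the basis, the coefficients act on the right, so
    they come out of [f] to the right of the entries of the matrix of [f]. *)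
Lemma mx_of_rendM : {morph @mx_of_rend K A B n b : f g / f * g}.
Proof.
move=> f g; apply/matrixP => i j; rewrite [LHS]mxE [RHS]mxE.
transitivity (rcoord b i (f (g (b`_j ⊗ 1 : rtensor B A)))) => //.
rewrite (mx_of_rendP _ _ b_basis) raddf_sum.
rewrite [LHS](big_morph _ (rcoordD b i) (raddf0 (tensor_lift _))).
apply: eq_bigr => k _; rewrite [X in rcoord b i X]rEndZ rcoordZ.
by congr (_ * _); rewrite mxE.
Qed.

Lemma phi_hatE (gamma : 'I_n -> 'I_n -> A -> A) a (i j : 'I_n) :
  phi_hat b gamma a i j = gamma j i a.
Proof.
rewrite mxE (phi_chiE _ _ _ b_basis).
rewrite [LHS](big_morph _ (rcoordD b i) (raddf0 (tensor_lift _))).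
rewrite (bigD1 i) //= big1 => [|k ki]; rewrite rcoord_basis.
  by rewrite eqxx mul1r addr0.
by rewrite eq_sym (negPf ki) mul0r.
Qed.

Lemma phi_chi_morphismP (gamma : 'I_n -> 'I_n -> A -> A) :
  rend_algebra_morphism (phi_chi b gamma) <->
  matrix_representation (phi_hat b gamma).
Proof.
apply: (algebra_morphism_comp_inj _ mx_of_rend_inj mx_of_rendD _ mx_of_rendZ).
by split; [exact: mx_of_rend1|exact: mx_of_rendM].
Qed.

Lemma phi_hat_representationP (gamma : 'I_n -> 'I_n -> {linear A -> A}) :
  (forall i j : 'I_n, gamma i j 1 = (i == j)%:R) /\
  (forall (i k : 'I_n) (a a' : A),
     gamma i k (a * a') = \sum_(j < n) gamma j k a * gamma i j a') <->
  matrix_representation (phi_hat b gamma).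
Proof.
split=> [[gamma1 gammaM]|[_ [phi1 phiM]]]; last first.
  split=> [i j|i k a a']; rewrite -(phi_hatE (fun i j => gamma i j)).
    by rewrite phi1 mxE eq_sym.
  by rewrite phiM mxE; apply: eq_bigr => j _; rewrite !phi_hatE.
split; first by move=> c x y; apply/matrixP => i j; rewrite !(phi_hatE, mxE) linearP.
split=> [|a a']; apply/matrixP => i j; rewrite phi_hatE.
  by rewrite gamma1 mxE eq_sym.
by rewrite gammaM mxE; apply: eq_bigr => k _; rewrite !phi_hatE.
Qed.

End MatrixOfEndomorphism.

Theorem proposition2p5 (K : fieldType) (A : algType K) (B : falgType K)
    (n : nat) (b : n.-tuple B) (b_basis : basis_of fullv b)
    (chi : {linear (A ⊗ B)%type -> (B ⊗ A)%type})
    (gamma : 'I_n -> 'I_n -> {linear A -> A})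
    (chi_gamma : forall (a : A) (i : 'I_n),
       chi (a ⊗ b`_i) = \sum_(j < n) b`_j ⊗ gamma i j a) :
  let conditions :=
    (forall i j : 'I_n, gamma i j 1 = (i == j)%:R) /\
    (forall (i k : 'I_n) (a a' : A),
       gamma i k (a * a') = \sum_(j < n) gamma j k a * gamma i j a') in
  (conditions <-> rend_algebra_morphism (phi_chi b gamma)) /\
  (conditions <-> matrix_representation (phi_hat b gamma)).
Proof.
move=> conditions; have hatP := phi_hat_representationP b_basis gamma.
split; last exact: hatP.
exact: iff_trans hatP (iff_sym (phi_chi_morphismP b_basis _)).
Qed.
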